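(* Let $\delta$ be a positive infinitesimal in ${}^*\mathbb{R}$ and suppose that $[f]\in\mathcal{G}$ has strong $\delta$-good numbers. Then $[f]\in\mathcal{G}^0$, i.e. $[f]$ is the germ of a function continuous on a neighborhood of $0$.
   Context: A sufficiently saturated nonstandard extension $X\mapsto{}^*X$ (at least an enlargement) is fixed. $\mu(0)_+$ denotes the set of positive infinitesimals of ${}^*\mathbb{R}$. For $n\in\mathbb{N}$ and $\delta\in\mu(0)_+$, $B_\delta=\{\xi\in{}^*\mathbb{R}^n:|\xi|\le\delta\}$. $\mathcal{G}=\mathcal{G}_{n,1}$ is the ring of germs at $0$ of arbitrary functions $f:(\mathbb{R}^n,0)\to(\mathbb{R},0)$ (defined on a neighborhood of $0$, $f(0)=0$), and $\mathcal{G}^0\subset\mathcal{G}$ is the subring of germs of functions continuous on a neighborhood of $0$. $\mathcal{M}$ is the set of germs at $0$ of functions $m:\mathbb{R}_+\to\mathbb{R}_+$ ($\mathbb{R}_+=(0,\infty)$) with $\lim_{t\to0}m(t)=0$ and $m(r)<m(t)$ for all sufficiently small $r<t$ in $\mathbb{R}_+$. For $\kappa,\delta\in\mu(0)_+$, write $\kappa\lll\delta$ ($\kappa$ is incomparably smaller than $\delta$) if ${}^*m(\delta)>\kappa$ for all $[m]\in\mathcal{M}$. For $\kappa\lll\delta$ and a nonzero germ $[f]\in\mathcal{G}$, $\kappa$ is strongly $[f]$-good for $\delta$ if for all $\xi,\zeta\in B_\delta$ with $|\xi-\zeta|$ sufficiently small (i.e. smaller than some fixed positive $\eta\in{}^*\mathbb{R}$)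 one has $|{}^*f(\xi)-{}^*f(\zeta)|<\kappa$. $[f]$ has strong $\delta$-good numbers if for some $\kappa\lll\delta$, $\kappa$ is strongly $[f]$-good for $\delta$. *)

(* Defs.v *)
From mathcomp Require Import all_boot all_order all_algebra.
From mathcomp Require Import all_classical all_reals all_analysis.
Import Order.TTheory GRing.Theory Num.Theory.
Import numFieldNormedType.Exports.

Set Implicit Arguments.
Unset Strict Implicit.
Unset Printing Implicit Defensive.

Local Open Scope classical_set_scope.
Local Open Scope ring_scope.

(** * Nonstandard extensions

  The language has one sort for every type [X], a constant for every [x : X],
  a function symbol for every [f : X -> Y], pairing, and a predicate symbol for
  every [A : set X]; since [set X] and [X -> Y] are themselves sorts (with
  membership and evaluation as standard relation and function), its first-order
  formulas cover the bounded formulas of the superstructure language.  Variables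
  are de Bruijn indices in a context, the list of the sorts in scope. *)

Inductive var : seq Type -> Type -> Type :=
| VZ X Γ : var (X :: Γ) X
| VS X Y Γ : var Γ X -> var (Y :: Γ) X.

Inductive term (Γ : seq Type) : Type -> Type :=
| Var X : var Γ X -> term Γ X
| Cst X : X -> term Γ X
| App X Y : (X -> Y) -> term Γ X -> term Γ Y
| Pair X Y : term Γ X -> term Γ Y -> term Γ (X * Y)%type.

Inductive formula : seq Type -> Type :=
| Equal Γ X : term Γ X -> term Γ X -> formula Γ
| Mem Γ X : set X -> term Γ X -> formula Γ
| Not Γ : formula Γ -> formula Γ
| And Γ : formula Γ -> formula Γ -> formula Γ
| Or Γ : formula Γ -> formula Γ -> formula Γ
| Imp Γ : formula Γ -> formula Γ -> formula Γ
| All Γ X : formula (X :: Γ) -> formula Γ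
| Ex Γ X : formula (X :: Γ) -> formula Γ.

(** [star X], [std x], [fext f], [sext A] are *X, *x, *f, *A. *)
Record interpretation := Interpretation {
  star :> Type -> Type;
  std : forall X, X -> star X;
  fext : forall X Y, (X -> Y) -> star X -> star Y;
  spair : forall X Y, star X -> star Y -> star (X * Y)%type;
  sext : forall X, set X -> set (star X) }.

Definition standard : interpretation :=
  @Interpretation (fun X => X) (fun _ x => x) (fun _ _ f => f)
    (fun _ _ x y => (x, y)) (fun _ A => A).

Section semantics.
Variable N : interpretation.

Fixpoint env (Γ : seq Type) : Type :=
  if Γ is X :: Γ' then (N X * env Γ')%type else unit.

Fixpoint lookup Γ X (v : var Γ X) : env Γ -> N X :=
  match v with
  | VZ _ _ => fun e => e.1
  | VS _ _ _ v' => fun e => lookup v' e.2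
  end.

Fixpoint term_value Γ X (t : term Γ X) (e : env Γ) : N X :=
  match t with
  | Var _ v => lookup v e
  | Cst _ x => std N x
  | App _ _ f t' => fext f (term_value t' e)
  | Pair _ _ t1 t2 => spair (term_value t1 e) (term_value t2 e)
  end.

Fixpoint holds Γ (φ : formula Γ) : env Γ -> Prop :=
  match φ with
  | Equal _ _ t1 t2 => fun e => term_value t1 e = term_value t2 e
  | Mem _ _ A t => fun e => sext A (term_value t e)
  | Not _ ψ => fun e => ~ holds ψ e
  | And _ ψ1 ψ2 => fun e => holds ψ1 e /\ holds ψ2 e
  | Or _ ψ1 ψ2 => fun e => holds ψ1 e \/ holds ψ2 e
  | Imp _ ψ1 ψ2 => fun e => holds ψ1 e -> holds ψ2 e
  | All _ X ψ => fun e => forall x : N X, holds ψ (x, e)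
  | Ex _ X ψ => fun e => exists x : N X, holds ψ (x, e)
  end.

End semantics.

(** The transfer principle. *)
Definition nonstandard_extension (N : interpretation) : Prop :=
  forall φ : formula [::], @holds standard [::] φ tt <-> @holds N [::] φ tt.

Definition enlargement (N : interpretation) : Prop :=
  nonstandard_extension N /\
  forall (X : Type) (F : set (set X)), finI F id ->
    exists ξ : N X, forall A, F A -> sext A ξ.

(** * Germs

  A germ along a filter is an equivalence class of total functions: every
  function defined on a member of the filter extends to a total one, and all
  its extensions have the same germ. *)

Definition germ (T U : Type) (F : set_system T) (f : T -> U) : set (T -> U) :=
  [set g | \forall x \near F, g x = f x].

Section germs_at_0.
Variables (R : realType) (n : nat).

Definition germ0 (f : 'rV[R]_n -> R) := germ (nbhs (0 : 'rV[R]_n)) f.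

Definition calG : set (set ('rV[R]_n -> R)) :=
  [set germ0 f | f in [set f : 'rV[R]_n -> R | f 0 = 0]].

Definition calG0 : set (set ('rV[R]_n -> R)) :=
  [set germ0 f | f in [set f : 'rV[R]_n -> R | f 0 = 0 /\
     \forall x \near (0 : 'rV[R]_n), {for x, continuous f}]].

(** The library norm on ['rV[R]_n] is the sup norm. *)
Definition enorm (x : 'rV[R]_n) : R := Num.sqrt (\sum_(i < n) x 0 i ^+ 2).

End germs_at_0.

(** The values of [m] outside [R_+ = (0, +oo)] are irrelevant. *)
Definition calM (R : realType) : set (set (R -> R)) :=
  [set germ (0 : R)^'+ m | m in [set m : R -> R |
    [/\ forall t, 0 < t -> 0 < m t,
        m t @[t --> (0 : R)^'+] --> (0 : R) &
        exists2 e, 0 < e & forall r t, 0 < r -> r < t -> t < e -> m r < m t]]].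

(** * Good numbers *)

Section good_numbers.
Variables (N : interpretation) (R : realType).

Definition slt (x y : N R) : Prop :=
  sext [set p : R * R | p.1 < p.2] (spair x y).

Definition sle (x y : N R) : Prop :=
  sext [set p : R * R | p.1 <= p.2] (spair x y).

Definition sdist (x y : N R) : N R :=
  fext (fun p : R * R => `|p.1 - p.2|) (spair x y).

Definition pos_infinitesimal (δ : N R) : Prop :=
  slt (std N (0 : R)) δ /\ forall r : R, 0 < r -> slt δ (std N r).

Definition incomparably_smaller (κ δ : N R) : Prop :=
  [/\ pos_infinitesimal κ, pos_infinitesimal δ &
      forall m : R -> R, calM (germ (0 : R)^'+ m) -> slt κ (fext m δ)].

Variable n : nat.

Definition sball (δ : N R) : set (N 'rV[R]_n) :=
  [set ξ | sle (fext (@enorm R n) ξ) δ].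

Definition sedist (ξ ζ : N 'rV[R]_n) : N R :=
  fext (fun p : 'rV[R]_n * 'rV[R]_n => enorm (p.1 - p.2)) (spair ξ ζ).

Definition strongly_good (f : 'rV[R]_n -> R) (κ δ : N R) : Prop :=
  exists2 η : N R, slt (std N (0 : R)) η &
    forall ξ ζ, sball δ ξ -> sball δ ζ -> slt (sedist ξ ζ) η ->
      slt (sdist (fext f ξ) (fext f ζ)) κ.

(** Strong goodness is a notion for nonzero germs only, hence the first
    conjunct. *)
Definition has_strong_good_numbers (f : 'rV[R]_n -> R) (δ : N R) : Prop :=
  germ0 f <> germ0 (fun=> 0) /\
  exists2 κ : N R, incomparably_smaller κ δ & strongly_good f κ δ.

End good_numbers.

(* Main.v *)
Require Import Defs.
From mathcomp Require Import all_boot all_order all_algebra.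
From mathcomp Require Import all_classical all_reals all_analysis.
Import Order.TTheory GRing.Theory Num.Theory.
Import numFieldNormedType.Exports.

(** The argument is by contraposition.  If [f] has discontinuities arbitrarily
    close to [0], then for every standard [t > 0] there is a size [ε > 0] such
    that jumps of [f] of size at least [ε] occur at arbitrarily short distances
    inside the ball of radius [t] ([jumps_near_0]).  The set of such sizes [ε] is
    closed downwards and grows with [t], so it admits a selection [m] belonging
    to the class [calM] of strictly increasing functions that tend to [0]
    ([calM_selection]).  By transfer, for every [η > 0] in [N R] two points of the
    ball of radius [δ] lie at distance less than [η] although the values of [f] at
    them differ by at least the value of [m] at [δ] ([star_jumps]).  A number
    incomparably smaller than [δ] lies below that value, so it cannot be strongly
    good for [f]. *)

Set Implicit Arguments.
Unset Strict Implicit.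
Unset Printing Implicit Defensive.

Local Open Scope classical_set_scope.
Local Open Scope ring_scope.

Section jumps.
Variables (R : realType) (n : nat).
Implicit Types (f : 'rV[R]_n -> R) (x y : 'rV[R]_n).

(** The negation, for a standard radius [t], of the condition defining strong
    goodness of [ε]. *)
Definition jumps f (t : R) : set R :=
  [set ε | forall η : R, 0 < η -> exists ξ ζ : 'rV[R]_n,
    [/\ enorm ξ <= t, enorm ζ <= t, enorm (ξ - ζ) < η &
        ε <= `|f ξ - f ζ|]].

Lemma jumps_downward f t ε ε' : ε' <= ε -> jumps f t ε -> jumps f t ε'.
Proof.
move=> le_ε J η /J[ξ [ζ [hξ hζ hd hf]]]; exists ξ, ζ; split => //.
exact: le_trans hf.
Qed.

Lemma jumps_mono f t t' ε : t <= t' -> jumps f t ε -> jumps f t' ε.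
Proof.
move=> le_t J η /J[ξ [ζ [hξ hζ hd hf]]]; exists ξ, ζ.
by split => //; exact: le_trans le_t.
Qed.

Lemma enorm_sub_continuous x :
  continuous (fun y : 'rV[R]_n => enorm (x - y) : R).
Proof.
move=> y; apply: (@continuous_cvg _ R R (nbhs y) _); first exact: sqrt_continuous.
apply: cvg_big => [|i _]; first exact: add_continuous.
have xy : (x - z) 0 i @[z --> y] --> (x - y) 0 i.
  rewrite !mxE; under eq_fun do rewrite !mxE.
  apply: (@cvgB _ R^o _ (nbhs y)).
    exact: cvg_cst.
  exact: coord_continuous.
exact: (cvgM xy xy).
Qed.

Lemma enormN x : enorm (- x) = enorm x.
Proof. by congr Num.sqrt; apply: eq_bigr => i _; rewrite mxE sqrrN. Qed.

Lemma enorm0 : enorm (0 : 'rV[R]_n) = 0.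
Proof.
rewrite /enorm big1 ?sqrtr0// => i _.
by rewrite mxE expr0n.
Qed.

Lemma near_enorm_lt x (t : R) : enorm x < t -> \forall y \near x, enorm y < t.
Proof.
move=> xt; have /(_ x)/(@cvgr_lt _ _ (nbhs x) _) := @enorm_sub_continuous 0.
rewrite sub0r enormN => /(_ t xt).
by apply: filterS => y; rewrite sub0r enormN.
Qed.

Lemma near_enorm_sub x (η : R) : 0 < η -> \forall y \near x, enorm (x - y) < η.
Proof.
move=> η0; have /(_ x)/(@cvgr_lt _ _ (nbhs x) _) := @enorm_sub_continuous x.
by rewrite subrr enorm0; apply.
Qed.

(** One of the two endpoints of each jump can be [x] itself; the other endpoint
    stays in the ball of radius [t] because [x] is in its interior. *)
Lemma discontinuity_jumps f x (t : R) : enorm x < t ->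
  ~ {for x, continuous f} -> exists2 ε, 0 < ε & jumps f t ε.
Proof.
move=> xt; apply: contra_notP => nojump.
apply/(@cvgrPdist_lt _ _ _ (nbhs x) _) => ε ε0.
apply: contrapT => nearF; apply: nojump; exists ε => // η η0.
apply: contrapT => noξζ; apply: nearF.
apply: (@filterS2 _ (nbhs x) _ _ _ _ _ (near_enorm_lt xt)
  (near_enorm_sub x η0)) => y yt xy; rewrite ltNge; apply/negP => jump.
by apply: noξζ; exists x, y; split => //; exact: ltW.
Qed.

Lemma jumps_near_0 f :
  ~ (\forall x \near (0 : 'rV[R]_n), {for x, continuous f}) ->
  forall t : R, 0 < t -> exists2 ε, 0 < ε & jumps f t ε.
Proof.
move=> ncont t t0; apply: contra_notP ncont => nojump.
have n0t : enorm (0 : 'rV[R]_n) < t by rewrite enorm0.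
apply: (@filterS _ (nbhs (0 : 'rV[R]_n)) _ _ _ _
  (near_enorm_lt n0t)) => x xt; apply: contrapT => ncont.
exact/nojump/(discontinuity_jumps xt ncont).
Qed.

End jumps.

(** With [h t] the supremum of [S t] truncated at [1], which is positive and
    nondecreasing, [m t = t * h t] works: the factor [t] makes [m] strictly
    increasing, forces it to tend to [0], and keeps it strictly below the
    supremum as long as [t < 1]. *)
Lemma calM_selection (R : realType) (S : R -> set R) :
  (forall t ε ε', ε' <= ε -> S t ε -> S t ε') ->
  (forall t t' ε, t <= t' -> S t ε -> S t' ε) ->
  (forall t, 0 < t -> exists2 ε, 0 < ε & S t ε) ->
  exists2 m : R -> R, calM (germ (0 : R)^'+ m) &
    forall t, 0 < t -> t < 1 -> S t (m t).
Proof.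
move=> Sdown Smono Spos.
pose T t := S t `&` [set ε | ε <= 1]; pose h t := sup (T t).
have Tpos t : 0 < t -> exists2 ε, 0 < ε & T t ε.
  move=> /Spos[ε ε0 Sε]; exists (Num.min ε 1); first by rewrite lt_min ε0 /=.
  by split; [apply: Sdown Sε|]; rewrite /= ge_min lexx ?orbT.
have Tub t : has_ubound (T t) by exists 1 => ε [].
have Tsup t : 0 < t -> has_sup (T t).
  by move=> /Tpos[ε _ Tε]; split => //; exists ε.
have h_gt0 t : 0 < t -> 0 < h t.
  by move=> /Tpos[ε ε0 Tε]; apply: (lt_le_trans ε0); exact: ub_le_sup.
have h_le1 t : 0 < t -> h t <= 1.
  by move=> /Tsup[T0 _]; apply: ge_sup => // ε [].
have h_mono r t : 0 < r -> r <= t -> h r <= h t.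
  move=> /Tsup[T0 _] rt; apply: ge_sup => // ε [Sε ε1].
  by apply: ub_le_sup => //; split => //; exact: Smono Sε.
exists (fun t => t * h t); last first.
  move=> t t0 t1; have : t * h t < h t by rewrite gtr_pMl// h_gt0.
  by move=> /sup_gt[|ε [Sε _] /ltW le_ε]; [exact: (Tsup t t0).1|exact: Sdown Sε].
exists (fun t => t * h t) => //; split.
- by move=> t t0; rewrite mulr_gt0// h_gt0.
- apply: (@squeeze_cvgr _ _ _ _ (fun=> 0) id).
  + near=> t; have t0 : 0 < t by near: t; exact: nbhs_right_gt.
    by rewrite mulr_ge0 ?ler_piMr ?h_le1// ltW ?h_gt0.
  + exact: cvg_cst.
  + exact: cvg_at_right_filter.
- exists 1 => // r t r0 rt _; apply: (@lt_le_trans _ _ (t * h r)).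
    by rewrite ltr_pM2r ?h_gt0.
  by rewrite ler_pM2l ?(lt_trans r0 rt)// h_mono// ltW.
Unshelve. all: end_near. Qed.

Section transfer.
Variables (N : interpretation) (hN : nonstandard_extension N) (R : realType).

Let lt_set := [set p : R * R | p.1 < p.2].
Let le_set := [set p : R * R | p.1 <= p.2].

Lemma star_lt_lt_le (x y z : N R) : slt x y -> slt y z -> sle z x -> False.
Proof.
pose v0 : var [:: R : Type; R : Type; R : Type] R := VZ _ _.
pose v1 : var [:: R : Type; R : Type; R : Type] R := VS _ (VZ _ _).
pose v2 : var [:: R : Type; R : Type; R : Type] R := VS _ (VS _ (VZ _ _)).
pose φ : formula [::] := All (All (All
  (Imp (Defs.Mem lt_set (Pair (Var v2) (Var v1)))
  (Imp (Defs.Mem lt_set (Pair (Var v1) (Var v0)))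
  (Not (Defs.Mem le_set (Pair (Var v0) (Var v2)))))))).
have /hN : @holds standard [::] φ tt.
  move=> /= a b c ab bc ca.
  by have := lt_le_trans (lt_trans ab bc) ca; rewrite ltxx.
exact.
Qed.

Lemma star_jumps n (f : 'rV[R]_n -> R) (m : R -> R) :
  (forall t, 0 < t -> t < 1 -> jumps f t (m t)) ->
  forall δ η : N R, slt (std N 0) δ -> slt δ (std N 1) -> slt (std N 0) η ->
  exists ξ ζ : N 'rV[R]_n, [/\ sball δ ξ, sball δ ζ, slt (sedist ξ ζ) η &
    sle (fext m δ) (sdist (fext f ξ) (fext f ζ))].
Proof.
move=> Jm δ η δ0 δ1 η0.
pose V : Type := 'rV[R]_n.
(* [t'] and [e'] are [t] and [e] read under the two existential quantifiers. *)
pose t : var [:: R : Type; R : Type] R := VS _ (VZ _ _).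
pose e : var [:: R : Type; R : Type] R := VZ _ _.
pose t' : var [:: V; V; R : Type; R : Type] R := VS _ (VS _ t).
pose e' : var [:: V; V; R : Type; R : Type] R := VS _ (VS _ e).
pose x : var [:: V; V; R : Type; R : Type] V := VS _ (VZ _ _).
pose y : var [:: V; V; R : Type; R : Type] V := VZ _ _.
pose dist := fun p : R * R => `|p.1 - p.2|.
pose edist := fun p : V * V => enorm (p.1 - p.2).
pose φ : formula [::] := All (All
  (Imp (Defs.Mem lt_set (Pair (Cst _ 0) (Var t)))
  (Imp (Defs.Mem lt_set (Pair (Var t) (Cst _ 1)))
  (Imp (Defs.Mem lt_set (Pair (Cst _ 0) (Var e)))
  (Ex (Ex
    (And (Defs.Mem le_set (Pair (App (@enorm R n) (Var x)) (Var t')))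
    (And (Defs.Mem le_set (Pair (App (@enorm R n) (Var y)) (Var t')))
    (And (Defs.Mem lt_set (Pair (App edist (Pair (Var x) (Var y))) (Var e')))
         (Defs.Mem le_set (Pair (App m (Var t'))
            (App dist (Pair (App f (Var x)) (App f (Var y))))))))))))))).
have /hN : @holds standard [::] φ tt.
  move=> /= s ε s0 s1 ε0.
  by have [ξ [ζ [? ? ? ?]]] := Jm s s0 s1 ε ε0; exists ξ, ζ.
move=> /(_ δ η δ0 δ1 η0) [ξ [ζ [hξ [hζ [hd hf]]]]].
by exists ξ, ζ.
Qed.

End transfer.

Lemma strongly_good_continuous (N : interpretation) (R : realType) (n : nat)
    (f : 'rV[R]_n -> R) (κ δ : N R) : nonstandard_extension N ->
  incomparably_smaller κ δ -> strongly_good f κ δ ->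
  \forall x \near (0 : 'rV[R]_n), {for x, continuous f}.
Proof.
move=> hN [_ [δ0 δ_small] κm] [η η0 good]; apply: contrapT => /jumps_near_0 J.
have [m /κm κ_lt_m Jm] := calM_selection (@jumps_downward R n f)
  (@jumps_mono R n f) J.
have [ξ [ζ [hξ hζ hd]]] := star_jumps hN Jm δ0 (δ_small 1 ltr01) η0.
exact: (star_lt_lt_le hN (good ξ ζ hξ hζ hd) κ_lt_m).
Qed.

Lemma calG_at0 (R : realType) (n : nat) (f : 'rV[R]_n -> R) :
  calG (germ0 f) -> f 0 = 0.
Proof.
move=> [g g0 gf]; have : germ0 g f by rewrite gf; exact: nearW.
by move=> /nbhs_singleton ->.
Qed.

Theorem proposition2p2 (N : interpretation) (hN : enlargement N)
    (R : realType) (n : nat) (δ : N R) (hδ : pos_infinitesimal δ)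
    (f : 'rV[R]_n -> R) (hf : calG (germ0 f))
    (hgood : has_strong_good_numbers f δ) :
  calG0 (germ0 f).
Proof.
case: hgood => _ [κ κδ good]; exists f => //; split; first exact: calG_at0.
exact: (strongly_good_continuous hN.1 κδ good).
Qed.
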